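(* Let $n\ge 4$ and let $\lambda\in\mathrm{Hom}(\Lambda_n,\mathbb{C}^* )$ be a linear part with nontriviality index $\iota(\lambda)>2$. If $[\rho]\in\mathrm{PH}_\lambda$ has a finite orbit under the action of the pure braid group $\mathrm{PB}_n\mathbb{D}$, then for each $i\in\{1,\dots,n\}$ such that $\lambda_i=1$, we have $\rho(\alpha_i)=\mathrm{Id}_{\mathbb{C}}$.
   Context: $\Lambda_n$ is the fundamental group of the Riemann sphere minus $n$ points, $\Lambda_n=\langle\alpha_1,\dots,\alpha_n\mid\alpha_1\cdots\alpha_n=1\rangle$. $\mathrm{Aff}(\mathbb{C})$ is the group of maps $z\mapsto az+b$ of $\mathbb{C}$, $a\in\mathbb{C}^*$, $b\in\mathbb{C}$, under composition. For $\rho\in\mathrm{Hom}(\Lambda_n,\mathrm{Aff}(\mathbb{C}))$ write $\rho(\alpha_i):z\mapsto\lambda_iz+\tau_i$. The homomorphism $\lambda:\Lambda_n\to\mathbb{C}^*$, $\lambda(\alpha_i)=\lambda_i$, identified with $(\lambda_1,\dots,\lambda_n)$ (so $\lambda_1\cdots\lambda_n=1$), is the linear part of $\rho$; $(\tau_1,\dots,\tau_n)$ is its translation part. The nontriviality index $\iota(\lambda)$ is the number of $i$ with $\lambda_i\ne1$. $\mathrm{Hom}_\lambda(\Lambda_n,\mathrm{Aff}(\mathbb{C}))$ is the set of $\rho$ with linear part $\lambda$, a vector space with coordinates $(\tau_1,\dots,\tau_{n-1})$. Conjugation by $z\mapsto az+b$ replaces $(\tau_i)$ by $(a\tau_i+b(1-\lambda_i))$.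 For $\lambda$ nontrivial, $\mathrm{H}_\lambda:=\mathrm{Hom}_\lambda(\Lambda_n,\mathrm{Aff}(\mathbb{C}))/\mathbb{C}(1-\lambda_1,\dots,1-\lambda_{n-1})\cong\mathbb{C}^{n-2}$ (in other terms, the first cohomology of the punctured sphere with coefficients in the rank one local system of monodromy $\lambda$), and $\mathrm{PH}_\lambda\cong\mathbb{P}^{n-3}(\mathbb{C})$ is its projectivization. Its points are the $\mathrm{Aff}(\mathbb{C})$-conjugacy classes $[\rho]$ of those $\rho$ with linear part $\lambda$ that are not conjugate to a representation with all $\tau_i=0$. The pure braid group $\mathrm{PB}_n\mathbb{D}$ of the disk is generated by the pure braids $\sigma_{i,j}^2$ $(1\le i<j\le n)$. It acts on $\mathrm{Hom}(\Lambda_n,\mathrm{Aff}(\mathbb{C}))$ by $\beta\cdot\rho=\rho\circ\mathrm{Hur}(\beta)$, where $\mathrm{Hur}$ is the antimorphism to $\mathrm{Aut}(\Lambda_n)$ (Hurwitz action) for which $\sigma_{i,j}$ acts by $\alpha_i\mapsto(\alpha_i\cdots\alpha_{j-1})\alpha_j(\alpha_i\cdots\alpha_{j-1})^{-1}$, $\alpha_j\mapsto(\alpha_{i+1}\cdots\alpha_{j-1})^{-1}\alpha_i(\alpha_{i+1}\cdots\alpha_{j-1})$, $\alpha_k\mapsto\alpha_k$ for $k\ne i,j$, and $\sigma_{i,j}^2$ acts by the square of this automorphism. This action preserves linear parts and induces an action on $\mathrm{PH}_\lambda$. *)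

(* Defs.v *)
From HB Require Import structures.
From mathcomp Require Import all_boot all_order all_algebra generic_quotient.
From mathcomp Require Import boolp classical_sets functions cardinality reals.
From mathcomp Require Import complex.

Set Implicit Arguments.
Unset Strict Implicit.
Unset Printing Implicit Defensive.

Import GRing.Theory.

Local Open Scope classical_set_scope.
Local Open Scope quotient_scope.
Local Open Scope group_scope.

(* The letter (x, true) stands for the generator x, (x, false) for x^-1. *)
Definition word (X : choiceType) := seq (X * bool).

Section Presentation.
Variables (X : choiceType) (rel : word X -> Prop).

Inductive pres_eq : word X -> word X -> Prop :=
| pres_refl u : pres_eq u u
| pres_sym u v : pres_eq u v -> pres_eq v u
| pres_trans u v w : pres_eq u v -> pres_eq v w -> pres_eq u w
| pres_cancel u x b v : pres_eq (u ++ (x, b) :: (x, ~~ b) :: v) (u ++ v)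
| pres_rel u r v : rel r -> pres_eq (u ++ r ++ v) (u ++ v).

Definition pres_eqb (u v : word X) : bool := `[< pres_eq u v >].

Lemma pres_eqb_refl : reflexive pres_eqb.
Proof. by move=> u; apply/asboolP; apply: pres_refl. Qed.

Lemma pres_eqb_sym : symmetric pres_eqb.
Proof.
by move=> u v; apply/asboolP/asboolP; apply: pres_sym.
Qed.

Lemma pres_eqb_trans : transitive pres_eqb.
Proof.
move=> v u w /asboolP uv /asboolP vw; apply/asboolP.
exact: pres_trans uv vw.
Qed.

Canonical pres_equiv :=
  EquivRel pres_eqb pres_eqb_refl pres_eqb_sym pres_eqb_trans.

Definition presented := {eq_quot pres_equiv}.
HB.instance Definition _ := Choice.on presented.
HB.instance Definition _ := EqQuotient.on presented.

Definition pres_class (u : word X) : presented := \pi_presented u.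

Lemma pres_classP u v : pres_class u = pres_class v <-> pres_eq u v.
Proof.
split=> [/eqP|uv]; last by apply/eqP; rewrite /pres_class eqmodE; apply/asboolP.
by rewrite /pres_class eqmodE => /asboolP.
Qed.

Lemma pres_reprK (x : presented) : pres_class (repr x) = x.
Proof. exact: reprK. Qed.

Lemma pres_repr u : pres_eq (repr (pres_class u)) u.
Proof. by apply/pres_classP; rewrite pres_reprK. Qed.

Definition word_inv (u : word X) : word X :=
  rev [seq (p.1, ~~ p.2) | p <- u].

Lemma pres_eq_catl w u v : pres_eq u v -> pres_eq (w ++ u) (w ++ v).
Proof.
elim=> {u v} [u|u v _|u v t _ uv _|u x b v|u r v rr].
- exact: pres_refl.
- exact: pres_sym.
- exact: pres_trans uv.
- by rewrite !catA; apply: pres_cancel.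
- by rewrite [w ++ (u ++ _)]catA [w ++ (u ++ _)]catA; apply: pres_rel.
Qed.

Lemma pres_eq_catr w u v : pres_eq u v -> pres_eq (u ++ w) (v ++ w).
Proof.
elim=> {u v} [u|u v _|u v t _ uv _|u x b v|u r v rr].
- exact: pres_refl.
- exact: pres_sym.
- exact: pres_trans uv.
- by rewrite -!catA /=; apply: pres_cancel.
- by rewrite -!catA; apply: pres_rel.
Qed.

Lemma pres_eq_cat u u' v v' :
  pres_eq u u' -> pres_eq v v' -> pres_eq (u ++ v) (u' ++ v').
Proof.
by move=> uu' vv'; apply: pres_trans (pres_eq_catr _ uu') (pres_eq_catl _ vv').
Qed.

Lemma word_invK : involutive word_inv.
Proof.
move=> u; rewrite /word_inv map_rev revK -map_comp.
by rewrite -[RHS]map_id; apply: eq_map => -[x b] /=; rewrite negbK.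
Qed.

Lemma word_inv_cat u v : word_inv (u ++ v) = word_inv v ++ word_inv u.
Proof. by rewrite /word_inv map_cat rev_cat. Qed.

Lemma pres_eq_mulwV u : pres_eq (u ++ word_inv u) [::].
Proof.
elim: u => [|[x b] u IH]; first exact: pres_refl.
rewrite -cat1s word_inv_cat -catA [u ++ _]catA.
apply: pres_trans (pres_cancel [::] x b [::]) => /=.
rewrite -[[:: (x, b); _]]/([:: (x, b)] ++ [::] ++ [:: (x, ~~ b)]).
by apply: (pres_eq_catl [:: (x, b)]); apply: pres_eq_catr.
Qed.

Lemma pres_eq_mulVw u : pres_eq (word_inv u ++ u) [::].
Proof. by rewrite -{2}[u]word_invK; apply: pres_eq_mulwV. Qed.

Lemma pres_eq_inv u v : pres_eq u v -> pres_eq (word_inv u) (word_inv v).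
Proof.
move=> uv; apply: (@pres_trans _ (word_inv u ++ (v ++ word_inv v))).
  rewrite -{1}[word_inv u]cats0; apply: pres_eq_catl.
  exact/pres_sym/pres_eq_mulwV.
rewrite catA -[X in pres_eq _ X]cat0s; apply: pres_eq_catr.
apply: pres_trans (pres_eq_mulVw u).
exact/pres_eq_catl/pres_sym.
Qed.

Definition pres_mul (x y : presented) := pres_class (repr x ++ repr y).
Definition pres_inv (x : presented) := pres_class (word_inv (repr x)).
Definition pres_one : presented := pres_class [::].

Lemma pres_class_cat u v :
  pres_class (u ++ v) = pres_mul (pres_class u) (pres_class v).
Proof.
by apply/pres_classP/pres_eq_cat; apply: pres_sym; apply: pres_repr.
Qed.

Lemma pres_class_inv u : pres_class (word_inv u) = pres_inv (pres_class u).
Proof. by apply/pres_classP/pres_eq_inv/pres_sym/pres_repr. Qed.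

Lemma pres_mulA : associative pres_mul.
Proof.
move=> x y z; rewrite -[x]pres_reprK -[y]pres_reprK -[z]pres_reprK.
by rewrite -!pres_class_cat catA.
Qed.

Lemma pres_mul1 : left_id pres_one pres_mul.
Proof. by move=> x; rewrite -[x]pres_reprK -pres_class_cat. Qed.

Lemma pres_mulr1 : right_id pres_one pres_mul.
Proof. by move=> x; rewrite -[x]pres_reprK -pres_class_cat cats0. Qed.

Lemma pres_mulV : left_inverse pres_one pres_inv pres_mul.
Proof.
move=> x; rewrite -[x]pres_reprK -pres_class_inv -pres_class_cat.
exact/pres_classP/pres_eq_mulVw.
Qed.

Lemma pres_mulrV : right_inverse pres_one pres_inv pres_mul.
Proof.
move=> x; rewrite -[x]pres_reprK -pres_class_inv -pres_class_cat.
exact/pres_classP/pres_eq_mulwV.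
Qed.

HB.instance Definition _ := isGroup.Build presented
  pres_mulA pres_mul1 pres_mulr1 pres_mulV pres_mulrV.

Definition pres_gen (x : X) : presented := pres_class [:: (x, true)].

Section Lift.
Variables (G : groupType) (f : X -> G).

Definition word_eval (u : word X) : G :=
  \big[*%g/1]_(p <- u) (if p.2 then f p.1 else (f p.1)^-1).

(* The morphism sending each generator x to f x; meaningful only when
   f satisfies the relators. *)
Definition pres_lift (x : presented) : G := word_eval (repr x).

Lemma word_eval_cat u v : word_eval (u ++ v) = word_eval u * word_eval v.
Proof. exact: big_cat. Qed.

Lemma word_eval_cons p u :
  word_eval (p :: u) = (if p.2 then f p.1 else (f p.1)^-1) * word_eval u.
Proof. exact: big_cons. Qed.

Hypothesis f_rel : forall r, rel r -> word_eval r = 1.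

Lemma word_eval_eq u v : pres_eq u v -> word_eval u = word_eval v.
Proof.
elim=> {u v} [//|u v _ -> //|u v w _ -> _ -> //|u x b v|u r v rr].
  rewrite !word_eval_cat; congr (_ * _); rewrite !word_eval_cons /=.
  by case: b => /=; [apply: mulVKg | apply: mulKg].
by rewrite !word_eval_cat (f_rel rr) mul1g.
Qed.

Lemma pres_lift_class u : pres_lift (pres_class u) = word_eval u.
Proof. exact/word_eval_eq/pres_repr. Qed.

Lemma pres_lift_gen x : pres_lift (pres_gen x) = f x.
Proof. by rewrite pres_lift_class /word_eval big_seq1. Qed.

Lemma pres_liftM : {morph pres_lift : x y / x * y}.
Proof.
move=> x y; rewrite -[x * y]/(pres_mul x y) /pres_mul pres_lift_class.
exact: word_eval_cat.
Qed.

End Lift.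

Lemma pres_class_eval u : pres_class u = word_eval pres_gen u.
Proof.
elim: u => [|[x b] u IH]; first by rewrite /word_eval big_nil.
rewrite word_eval_cons -IH -cat1s pres_class_cat; congr (_ * _) => /=.
by case: b => //; rewrite -[LHS]/(pres_class (word_inv [:: (x, true)])) pres_class_inv.
Qed.
End Presentation.

Definition sphere_word (n : nat) : word 'I_n := [seq (i, true) | i <- enum 'I_n].

Definition sphere_rel (n : nat) (r : word 'I_n) : Prop := r = sphere_word n.

Definition Lambda (n : nat) := presented (@sphere_rel n).
HB.instance Definition _ (n : nat) := Group.on (Lambda n).

Definition alpha (n : nat) (i : 'I_n) : Lambda n := pres_gen (@sphere_rel n) i.

Lemma word_eval_sphere (G : groupType) (n : nat) (f : 'I_n -> G) :
  word_eval f (sphere_word n) = \big[*%g/1]_(i < n) f i.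
Proof. by rewrite /word_eval big_map enumT [index_enum _]unlock. Qed.

Lemma prod_alpha (n : nat) : \big[*%g/1]_(i < n) alpha i = 1.
Proof.
rewrite -(word_eval_sphere (@alpha n)) -pres_class_eval.
by apply/pres_classP; rewrite -[sphere_word n]cats0; apply: (@pres_rel _ _ [::]).
Qed.

Definition alpha_prod (n a b : nat) : Lambda n :=
  \big[*%g/1]_(k < n | a <= k < b) alpha k.

Definition hurwitz_gen (n : nat) (i j k : 'I_n) : Lambda n :=
  if k == i then alpha_prod n i j * alpha j * (alpha_prod n i j)^-1
  else if k == j then (alpha_prod n i.+1 j)^-1 * alpha i * alpha_prod n i.+1 j
  else alpha k.

(* The automorphism by which the braid sigma_{i,j} acts; used only for i < j
   (otherwise hurwitz_gen need not respect the relator). *)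
Definition hurwitz (n : nat) (i j : 'I_n) : Lambda n -> Lambda n :=
  pres_lift (hurwitz_gen i j).

Lemma alpha_prod_nat (n a b : nat) (F : nat -> Lambda n) :
  (forall k : 'I_n, F k = alpha k) -> b <= n ->
  alpha_prod n a b = \big[*%g/1]_(a <= k < b) F k.
Proof.
move=> FE bn; rewrite /alpha_prod -(eq_bigr _ (fun k _ => FE k)).
rewrite -(big_mkord (fun k => a <= k < b) F).
have [ab|ba] := leqP a b; last first.
  rewrite [RHS]big_geq ?(ltnW ba)// big1_seq// => k /andP[/andP[ak kb] _].
  by have := leq_trans ba (leq_trans ak (ltnW kb)); rewrite ltnn.
rewrite (@big_cat_nat _ _ _ a 0 n) ?(leq_trans ab bn)//=.
rewrite (@big_cat_nat _ _ _ b a n) //=.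
rewrite big_nat_cond big1 ?mul1g; last first.
  by move=> k /andP[/andP[_ ka] /andP[ak _]]; move: ka; rewrite ltnNge ak.
rewrite [X in _ * X]big_nat_cond [X in _ * X]big1 ?mulg1; last first.
  by move=> k /andP[/andP[bk _] /andP[_ kb]]; move: kb; rewrite ltnNge bk.
rewrite big_nat_cond [RHS]big_nat_cond; apply: eq_bigl => k.
by rewrite andbT; case: (a <= k < b).
Qed.

Lemma hurwitz_rel (n : nat) (i j : 'I_n) : i < j ->
  forall r, sphere_rel r -> word_eval (hurwitz_gen i j) r = 1.
Proof.
move=> ij r ->; rewrite word_eval_sphere.
pose F k : Lambda n := if insub k is Some o then alpha o else 1.
have FE (k : 'I_n) : F k = alpha k by rewrite /F valK.
pose H k : Lambda n := if insub k is Some o then hurwitz_gen i j o else 1.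
have HE (k : 'I_n) : H k = hurwitz_gen i j k by rewrite /H valK.
have HF (k : nat) : k != i :> nat -> k != j :> nat -> H k = F k.
  rewrite /H /F; case: insubP => // o _ <- ki kj.
  by rewrite /hurwitz_gen -!val_eqE /= (negbTE ki) (negbTE kj).
have split5 (K : nat -> Lambda n) : \big[*%g/1]_(0 <= k < n) K k =
    \big[*%g/1]_(0 <= k < i) K k * (K i * (\big[*%g/1]_(i.+1 <= k < j) K k *
    (K j * \big[*%g/1]_(j.+1 <= k < n) K k))).
  rewrite (@big_cat_nat _ _ _ i 0 n) ?(ltnW (ltn_ord i))//=; congr (_ * _).
  rewrite big_ltn//; congr (_ * _).
  rewrite (@big_cat_nat _ _ _ j i.+1 n) ?(ltnW (ltn_ord j))//=.
  by congr (_ * _); rewrite big_ltn.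
apply: etrans (prod_alpha n).
under eq_bigr => k _ do rewrite -HE.
under [RHS]eq_bigr => k _ do rewrite -FE.
rewrite -(big_mkord xpredT H) -(big_mkord xpredT F) !split5; congr (_ * _).
  apply: eq_big_nat => k /andP[_ ki].
  by apply: HF; rewrite ltn_eqF// (ltn_trans ki).
rewrite [X in _ * (X * _)](_ : _ = \big[*%g/1]_(i.+1 <= k < j) F k); last first.
  apply: eq_big_nat => k /andP[ik kj].
  by apply: HF; [rewrite gtn_eqF | rewrite ltn_eqF].
rewrite [X in _ * (_ * (_ * X))](_ : _ = \big[*%g/1]_(j.+1 <= k < n) F k); last first.
  apply: eq_big_nat => k /andP[jk _].
  by apply: HF; rewrite gtn_eqF// (ltn_trans ij).
rewrite !HE !FE /hurwitz_gen !eqxx.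
have -> : (j == i) = false by rewrite -val_eqE /= gtn_eqF.
have jn := ltnW (ltn_ord j).
rewrite !(@alpha_prod_nat _ _ _ F FE jn) big_ltn// FE.
set P := \big[*%g/1]_(i.+1 <= k < j) F k.
by rewrite invgM !mulgA !(mulgK, mulgVK).
Qed.

Lemma hurwitzM (n : nat) (i j : 'I_n) : i < j ->
  {morph hurwitz i j : x y / x * y}.
Proof. by move=> ij; apply/pres_liftM/hurwitz_rel. Qed.

Lemma hurwitz_alpha (n : nat) (i j k : 'I_n) : i < j ->
  hurwitz i j (alpha k) = hurwitz_gen i j k.
Proof. by move=> ij; apply/pres_lift_gen/hurwitz_rel. Qed.

(* The image under Hur of the pure braid group of the disk: the subgroup of
   Aut(Lambda_n) generated by the squares of the automorphisms hurwitz i j,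
   the pure braids sigma_{i,j}^2 being generators. Only this image enters the
   action, beta . rho being rho \o Hur(beta). *)
Inductive pure_hurwitz (n : nat) : (Lambda n -> Lambda n) -> Prop :=
| pure_hurwitz_id : pure_hurwitz id
| pure_hurwitz_sqr (i j : 'I_n) : i < j ->
    pure_hurwitz (hurwitz i j \o hurwitz i j)
| pure_hurwitz_comp f g :
    pure_hurwitz f -> pure_hurwitz g -> pure_hurwitz (f \o g)
| pure_hurwitz_inv f g :
    pure_hurwitz f -> cancel f g -> cancel g f -> pure_hurwitz g.

Section Affine.
Variable R : realType.
Local Notation C := (R[i]).

Record Cstar := MkCstar { cval :> C; _ : cval != 0%R }.
HB.instance Definition _ := [isSub for cval].
HB.instance Definition _ := [Choice of Cstar by <:].

Lemma cval_neq0 (a : Cstar) : cval a != 0%R.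
Proof. by case: a. Qed.

Definition cstar_mul (a b : Cstar) : Cstar :=
  MkCstar (mulf_neq0 (cval_neq0 a) (cval_neq0 b)).
Definition cstar_one : Cstar := MkCstar (oner_neq0 C).

Lemma cstar_inv_subproof (a : Cstar) : ((cval a)^-1 != 0)%R.
Proof. by rewrite invr_eq0 cval_neq0. Qed.
Definition cstar_inv (a : Cstar) : Cstar := MkCstar (cstar_inv_subproof a).

Lemma cstar_mulA : associative cstar_mul.
Proof. by move=> a b c; apply: val_inj; apply: mulrA. Qed.
Lemma cstar_mul1 : left_id cstar_one cstar_mul.
Proof. by move=> a; apply: val_inj; apply: mul1r. Qed.
Lemma cstar_mulr1 : right_id cstar_one cstar_mul.
Proof. by move=> a; apply: val_inj; apply: mulr1. Qed.
Lemma cstar_mulV : left_inverse cstar_one cstar_inv cstar_mul.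
Proof. by move=> a; apply/val_inj/mulVf/cval_neq0. Qed.
Lemma cstar_mulrV : right_inverse cstar_one cstar_inv cstar_mul.
Proof. by move=> a; apply/val_inj/mulfV/cval_neq0. Qed.

HB.instance Definition _ := isGroup.Build Cstar
  cstar_mulA cstar_mul1 cstar_mulr1 cstar_mulV cstar_mulrV.

Record Aff := MkAff { lin : Cstar; trans : C }.

Definition aff_fun (g : Aff) (z : C) : C := (cval (lin g) * z + trans g)%R.

Definition aff_pair (g : Aff) := (lin g, trans g).
Definition pair_aff (p : Cstar * C) := MkAff p.1 p.2.
Lemma aff_pairK : cancel aff_pair pair_aff. Proof. by case. Qed.
HB.instance Definition _ := Choice.copy Aff (can_type aff_pairK).

Definition aff_mul (g h : Aff) : Aff :=
  MkAff (lin g * lin h) (cval (lin g) * trans h + trans g)%R.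
Definition aff_one : Aff := MkAff 1 0%R.
Definition aff_inv (g : Aff) : Aff :=
  MkAff (lin g)^-1 (- ((cval (lin g))^-1 * trans g))%R.

Lemma aff_fun_inj (g h : Aff) : aff_fun g =1 aff_fun h -> g = h.
Proof.
case: g h => [a b] [c d] E.
have bd : b = d by have := E 0%R; rewrite /aff_fun /= !mulr0 !add0r.
rewrite bd; congr MkAff; apply: val_inj.
by have := E 1%R; rewrite /aff_fun /= bd !mulr1 => /addIr.
Qed.

Lemma aff_funM (g h : Aff) : aff_fun (aff_mul g h) =1 aff_fun g \o aff_fun h.
Proof. by move=> z; rewrite /aff_fun /= mulrDr mulrA addrA. Qed.

Lemma aff_fun1 : aff_fun aff_one =1 id.
Proof. by move=> z; rewrite /aff_fun /= mul1r addr0. Qed.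

Lemma aff_funVK (g : Aff) : cancel (aff_fun g) (aff_fun (aff_inv g)).
Proof.
move=> z; rewrite /aff_fun /= mulrDr addrK mulrA mulVf ?mul1r//.
exact: cval_neq0.
Qed.

Lemma aff_funKV (g : Aff) : cancel (aff_fun (aff_inv g)) (aff_fun g).
Proof.
move=> z; rewrite /aff_fun /= mulrDr mulrN !mulrA mulfV ?cval_neq0//.
by rewrite !mul1r subrK.
Qed.

Lemma aff_mulA : associative aff_mul.
Proof. by move=> f g h; apply: aff_fun_inj => z; rewrite !(aff_funM, compE). Qed.
Lemma aff_mul1 : left_id aff_one aff_mul.
Proof. by move=> g; apply: aff_fun_inj => z; rewrite aff_funM /= aff_fun1. Qed.
Lemma aff_mulr1 : right_id aff_one aff_mul.
Proof. by move=> g; apply: aff_fun_inj => z; rewrite aff_funM /= aff_fun1. Qed.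
Lemma aff_mulV : left_inverse aff_one aff_inv aff_mul.
Proof.
by move=> g; apply: aff_fun_inj => z; rewrite aff_funM /= aff_funVK aff_fun1.
Qed.
Lemma aff_mulrV : right_inverse aff_one aff_inv aff_mul.
Proof.
by move=> g; apply: aff_fun_inj => z; rewrite aff_funM /= aff_funKV aff_fun1.
Qed.

HB.instance Definition _ := isGroup.Build Aff
  aff_mulA aff_mul1 aff_mulr1 aff_mulV aff_mulrV.

Variable n : nat.
Implicit Types (lambda : {multiplicative Lambda n -> Cstar}).
Implicit Types (rho : Lambda n -> Aff).

Definition nontriviality_index lambda : nat :=
  #|[pred i : 'I_n | lambda (alpha i) != 1]|.

Definition Hom_lambda lambda : set (Lambda n -> Aff) :=
  [set rho : Lambda n -> Aff | {morph rho : x y / x * y} /\ lin \o rho =1 lambda].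

Definition conj_class rho : set (Lambda n -> Aff) :=
  [set (fun x => g * rho x * g^-1) | g in [set: Aff]].

(* PH_lambda is the projectivization of H_lambda, seen as the set of the
   Aff(C)-conjugacy classes of the nonzero elements of Hom_lambda. *)
Definition PH lambda : set (set (Lambda n -> Aff)) :=
  [set conj_class rho | rho in Hom_lambda lambda `&`
    [set rho : Lambda n -> Aff | ~ exists2 rho', conj_class rho rho' &
                 forall i : 'I_n, trans (rho' (alpha i)) = 0%R]].

Definition braid_act (phi : Lambda n -> Lambda n) (P : set (Lambda n -> Aff)) :
    set (Lambda n -> Aff) :=
  [set rho \o phi | rho in P].

Definition pure_braid_orbit (P : set (Lambda n -> Aff)) :
    set (set (Lambda n -> Aff)) :=
  [set braid_act phi P | phi in @pure_hurwitz n].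

End Affine.

(* Main.v *)
(* Suppose lambda_i = 1 and tau_i <> 0. For lambda_j <> 1 the full twist of the
   strands i and j multiplies tau_i by lambda_j, adds a nonzero multiple
   (depending only on lambda) of tau_i to tau_j, and fixes the other tau_k.
   The commutator of the full twists of i with j and with k, where lambda_j and
   lambda_k are nontrivial, therefore fixes tau_i, adds a nonzero multiple of
   tau_i to tau_j, and touches no other strand than k. If two of its powers send
   [rho] to the same class, the conjugating affine map z |-> a z + b has a = 1
   because tau_i is fixed, and b = 0 because a third tau_l with lambda_l <> 1 is
   fixed, so the two powers agree. Hence the orbit is infinite. *)
Require Import Defs.
From mathcomp Require Import all_boot all_order all_algebra.
From mathcomp Require Import boolp classical_sets functions cardinality reals.
From mathcomp Require Import complex ring.

Set Implicit Arguments.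
Unset Strict Implicit.
Unset Printing Implicit Defensive.

Import GRing.Theory.

Local Open Scope classical_set_scope.
Local Open Scope group_scope.

(** * Ordered products over intervals of ['I_n] *)

(** Passing to indices in [nat] gives access to the splitting rules for intervals. The default value
    [1] is never reached, because [b <= n]. *)
Lemma prod_ord_interval (G : groupType) (n : nat) (f : 'I_n -> G) (a b : nat) :
  b <= n ->
  \big[*%g/1]_(k < n | a <= k < b) f k =
  \big[*%g/1]_(a <= k < b) oapp f 1 (insub k).
Proof.
move=> bn; rewrite (big_geq_mkord a b xpredT).
rewrite (big_ord_widen_cond n (leq a) (fun k => oapp f 1 (insub k)) bn).
by apply: eq_bigr => k _; rewrite valK.
Qed.

Lemma prod_ord_head (G : groupType) (n : nat) (f : 'I_n -> G) (i : 'I_n)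
    (b : nat) : i < b -> b <= n ->
  \big[*%g/1]_(k < n | i <= k < b) f k =
  f i * \big[*%g/1]_(k < n | i.+1 <= k < b) f k.
Proof. by move=> ib bn; rewrite !prod_ord_interval// big_ltn// valK. Qed.

Lemma prod_ord_cat (G : groupType) (n : nat) (f : 'I_n -> G) (a c b : nat) :
  a <= c <= b -> b <= n ->
  \big[*%g/1]_(k < n | a <= k < b) f k =
  \big[*%g/1]_(k < n | a <= k < c) f k * \big[*%g/1]_(k < n | c <= k < b) f k.
Proof.
move=> /andP[ac cb] bn; rewrite !prod_ord_interval ?(leq_trans cb)//.
exact: big_cat_nat.
Qed.

Lemma prod_ord_split (G : groupType) (n : nat) (f : 'I_n -> G) (i j : 'I_n) :
  i < j ->
  \big[*%g/1]_(k < n) f k =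
  \big[*%g/1]_(k < n | 0 <= k < i) f k *
  (f i * \big[*%g/1]_(k < n | i.+1 <= k < j) f k * f j) *
  \big[*%g/1]_(k < n | j.+1 <= k < n) f k.
Proof.
move=> ij; transitivity (\big[*%g/1]_(k < n | 0 <= k < n) f k).
  by apply: eq_bigl => k; rewrite ltn_ord.
rewrite (@prod_ord_cat _ _ _ 0 i n) ?(ltnW (ltn_ord i))//.
rewrite prod_ord_head// (@prod_ord_cat _ _ _ i.+1 j n) ?ij ?(ltnW (ltn_ord j))//.
by rewrite prod_ord_head// !mulgA.
Qed.

(** Only the block from [i] to [j] of the relator can change, so equality of the two block products
    suffices. *)
Lemma word_eval_rel_local (n : nat) (f : 'I_n -> Lambda n) (i j : 'I_n) :
  i < j -> (forall k, k != i -> k != j -> f k = alpha k) ->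
  f i * alpha_prod n i.+1 j * f j = alpha i * alpha_prod n i.+1 j * alpha j ->
  forall r, sphere_rel r -> word_eval f r = 1.
Proof.
move=> ij fE fij r ->; rewrite word_eval_sphere; apply: etrans (prod_alpha n).
rewrite (prod_ord_split f ij) (prod_ord_split (@alpha n) ij).
congr (_ * _ * _).
- by apply: eq_bigr => k ki; rewrite fE// -val_eqE /= ltn_eqF// (ltn_trans ki).
- rewrite -fij; congr (_ * _ * _); apply: eq_bigr => k /andP[ik kj].
  by rewrite fE// -val_eqE /= ?(gtn_eqF ik)// (ltn_eqF kj).
- apply: eq_bigr => k /andP[jk _].
  by rewrite fE// -val_eqE /= gtn_eqF// (ltn_trans ij).
Qed.

(** * Group morphisms, and morphisms out of [Lambda n] *)

Lemma morph_one (G H : groupType) (f : G -> H) :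
  {morph f : x y / x * y} -> f 1 = 1.
Proof. by move=> fM; apply: (mulgI (f 1)); rewrite -fM !mulg1. Qed.

Lemma morph_inv (G H : groupType) (f : G -> H) :
  {morph f : x y / x * y} -> {morph f : x / x^-1}.
Proof.
by move=> fM x; apply: (mulgI (f x)); rewrite -fM !mulgV (morph_one fM).
Qed.

Lemma morph_prod (G H : groupType) (f : G -> H) :
  {morph f : x y / x * y} -> forall (I : Type) (r : seq I) (P : pred I) F,
  f (\big[*%g/1]_(k <- r | P k) F k) = \big[*%g/1]_(k <- r | P k) f (F k).
Proof. by move=> fM I r P F; apply: big_morph => //; apply: morph_one. Qed.

(** Each element is the class of its representative word, hence a product of generators and their
    inverses. *)
Lemma Lambda_morph_eq (n : nat) (H : groupType) (f g : Lambda n -> H) :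
  {morph f : x y / x * y} -> {morph g : x y / x * y} ->
  (forall k, f (alpha k) = g (alpha k)) -> f =1 g.
Proof.
move=> fM gM fg x; rewrite -[x]pres_reprK pres_class_eval /word_eval.
rewrite (morph_prod fM) (morph_prod gM); apply: eq_bigr => -[k b] _ /=.
by case: b; rewrite /= ?(morph_inv fM) ?(morph_inv gM) fg.
Qed.

(** * Inverses of the Hurwitz automorphisms, and full twists *)

(** These values come from solving the formulas of [hurwitz_gen] for [alpha i] and [alpha j], with
    [Q] fixed. An explicit inverse is required by [pure_hurwitz_inv]. *)
Definition hurwitz_inv_gen (n : nat) (i j k : 'I_n) : Lambda n :=
  let Q := alpha_prod n i.+1 j in
  if k == i then Q * alpha j * Q^-1
  else if k == j then (Q * alpha j)^-1 * alpha i * (Q * alpha j)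
  else alpha k.

Definition hurwitz_inv (n : nat) (i j : 'I_n) : Lambda n -> Lambda n :=
  pres_lift (hurwitz_inv_gen i j).

Section Hurwitz.
Variables (n : nat) (i j : 'I_n).
Hypothesis ij : i < j.
Local Notation Q := (alpha_prod n i.+1 j).

Let jNi : (j == i) = false.
Proof. by rewrite -val_eqE /= gtn_eqF. Qed.

Lemma hurwitz_inv_rel r :
  sphere_rel r -> word_eval (hurwitz_inv_gen i j) r = 1.
Proof.
apply: (word_eval_rel_local ij).
  by move=> k ki kj; rewrite /hurwitz_inv_gen (negbTE ki) (negbTE kj).
rewrite /hurwitz_inv_gen !eqxx jNi /=.
by rewrite !invgM !mulgA !(mulgVK, mulgK, mulgV, mulVg, mul1g).
Qed.

Lemma hurwitz_invM : {morph hurwitz_inv i j : x y / x * y}.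
Proof. exact/pres_liftM/hurwitz_inv_rel. Qed.

Lemma hurwitz_inv_alpha k : hurwitz_inv i j (alpha k) = hurwitz_inv_gen i j k.
Proof. exact/pres_lift_gen/hurwitz_inv_rel. Qed.

Lemma alpha_prod_head : alpha_prod n i j = alpha i * Q.
Proof. by rewrite /alpha_prod prod_ord_head// ltnW. Qed.

Lemma hurwitz_alpha_l :
  hurwitz i j (alpha i) = (alpha i * Q) * alpha j * (alpha i * Q)^-1.
Proof. by rewrite hurwitz_alpha// /hurwitz_gen eqxx alpha_prod_head. Qed.

Lemma hurwitz_alpha_r : hurwitz i j (alpha j) = Q^-1 * alpha i * Q.
Proof. by rewrite hurwitz_alpha// /hurwitz_gen jNi eqxx. Qed.

Lemma hurwitz_alpha_id k : k != i -> k != j -> hurwitz i j (alpha k) = alpha k.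
Proof. by move=> /negPf ki /negPf kj; rewrite hurwitz_alpha// /hurwitz_gen ki kj. Qed.

Lemma hurwitz_inv_alpha_l : hurwitz_inv i j (alpha i) = Q * alpha j * Q^-1.
Proof. by rewrite hurwitz_inv_alpha /hurwitz_inv_gen eqxx. Qed.

Lemma hurwitz_inv_alpha_r :
  hurwitz_inv i j (alpha j) = (Q * alpha j)^-1 * alpha i * (Q * alpha j).
Proof. by rewrite hurwitz_inv_alpha /hurwitz_inv_gen jNi eqxx. Qed.

Lemma hurwitz_inv_alpha_id k :
  k != i -> k != j -> hurwitz_inv i j (alpha k) = alpha k.
Proof.
by move=> /negPf ki /negPf kj; rewrite hurwitz_inv_alpha /hurwitz_inv_gen ki kj.
Qed.

(** [Q] involves only generators strictly between [i] and [j]. *)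
Lemma morph_alpha_prod_id (f : Lambda n -> Lambda n) :
  {morph f : x y / x * y} ->
  (forall k, k != i -> k != j -> f (alpha k) = alpha k) -> f Q = Q.
Proof.
move=> fM fE; rewrite (morph_prod fM); apply: eq_bigr => k /andP[ik kj].
by rewrite fE// -val_eqE /= ?(gtn_eqF ik)// (ltn_eqF kj).
Qed.

Let hM := hurwitzM ij.
Let hV := morph_inv hM.
Let hQ : hurwitz i j Q = Q := morph_alpha_prod_id hM hurwitz_alpha_id.
Let gM := hurwitz_invM.
Let gV := morph_inv gM.
Let gQ : hurwitz_inv i j Q = Q := morph_alpha_prod_id gM hurwitz_inv_alpha_id.

Lemma hurwitzK : cancel (hurwitz i j) (hurwitz_inv i j).
Proof.
apply: (@Lambda_morph_eq _ _ _ id) => [x y|//|k /=]; first by rewrite hM gM.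
have [->|ki] := eqVneq k i.
  rewrite hurwitz_alpha_l !(gM, gV, gQ, hurwitz_inv_alpha_l, hurwitz_inv_alpha_r).
  by rewrite !invgM !invgK !mulgA !(mulgVK, mulgK, mulgV, mulVg, mul1g).
have [->|kj] := eqVneq k j.
  rewrite hurwitz_alpha_r !(gM, gV, gQ, hurwitz_inv_alpha_l).
  by rewrite !mulgA !(mulgVK, mulgK, mulgV, mulVg, mul1g).
by rewrite hurwitz_alpha_id// hurwitz_inv_alpha_id.
Qed.

Lemma hurwitz_invK : cancel (hurwitz_inv i j) (hurwitz i j).
Proof.
apply: (@Lambda_morph_eq _ _ _ id) => [x y|//|k /=]; first by rewrite gM hM.
have [->|ki] := eqVneq k i.
  rewrite hurwitz_inv_alpha_l !(hM, hV, hQ, hurwitz_alpha_r).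
  by rewrite !mulgA !(mulgVK, mulgK, mulgV, mulVg, mul1g).
have [->|kj] := eqVneq k j.
  rewrite hurwitz_inv_alpha_r !(hM, hV, hQ, hurwitz_alpha_r, hurwitz_alpha_l).
  by rewrite !invgM !invgK !mulgA !(mulgVK, mulgK, mulVg, mul1g).
by rewrite hurwitz_inv_alpha_id// hurwitz_alpha_id.
Qed.

Definition full_twist := hurwitz i j \o hurwitz i j.

Lemma full_twistM : {morph full_twist : x y / x * y}.
Proof. by move=> x y; rewrite /full_twist /= !hM. Qed.

(** The shape [x * y * x^-1] is kept here and in [full_twist_alpha_r], so that the formula for the
    translation part of a conjugate applies directly. *)
Lemma full_twist_alpha_l :
  full_twist (alpha i) = (alpha i * (Q * alpha j * Q^-1)) * alpha i *
                         (alpha i * (Q * alpha j * Q^-1))^-1.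
Proof.
rewrite /full_twist /= hurwitz_alpha_l.
rewrite !(hM, hV, hQ, hurwitz_alpha_r, hurwitz_alpha_l).
by rewrite !invgM !invgK !mulgA !(mulgVK, mulgK, mulgV, mulVg, mul1g).
Qed.

Lemma full_twist_alpha_r :
  full_twist (alpha j) =
  (Q^-1 * alpha i * Q) * alpha j * (Q^-1 * alpha i * Q)^-1.
Proof.
rewrite /full_twist /= hurwitz_alpha_r !(hM, hV, hQ, hurwitz_alpha_l).
by rewrite !invgM !invgK !mulgA.
Qed.

Lemma full_twist_alpha_id k : k != i -> k != j -> full_twist (alpha k) = alpha k.
Proof. by move=> ki kj; rewrite /full_twist /= !hurwitz_alpha_id. Qed.

Lemma pure_hurwitz_full_twist : pure_hurwitz full_twist.
Proof. exact: pure_hurwitz_sqr. Qed.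

Lemma full_twist_inv : exists2 psi, pure_hurwitz psi &
  cancel full_twist psi /\ cancel psi full_twist.
Proof.
have K1 : cancel full_twist (hurwitz_inv i j \o hurwitz_inv i j).
  exact: can_comp hurwitzK hurwitzK.
have K2 : cancel (hurwitz_inv i j \o hurwitz_inv i j) full_twist.
  exact: can_comp hurwitz_invK hurwitz_invK.
exists (hurwitz_inv i j \o hurwitz_inv i j) => //.
exact: pure_hurwitz_inv pure_hurwitz_full_twist K1 K2.
Qed.

End Hurwitz.

(** * Full twists in translation coordinates *)

Section Translation.
Variables (R : realType) (n : nat).
Local Notation C := (R[i]).
Implicit Types (g h : Aff R) (rho : Lambda n -> Aff R).

Lemma cstar_mulC (a b : Cstar R) : a * b = b * a.
Proof. by apply: val_inj; rewrite /= mulrC. Qed.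

Lemma trans_mul g h : trans (g * h) = (cval (lin g) * trans h + trans g)%R.
Proof. by []. Qed.

Lemma trans_inv g : trans g^-1 = (- ((cval (lin g))^-1 * trans g))%R.
Proof. by []. Qed.

Lemma lin_conj g h : lin (g * h * g^-1) = lin h.
Proof.
by apply: val_inj => /=; rewrite mulrAC mulfV ?mul1r ?cval_neq0.
Qed.

Lemma trans_conj g h : trans (g * h * g^-1) =
  (cval (lin g) * trans h + (1 - cval (lin h)) * trans g)%R.
Proof.
rewrite trans_mul trans_mul trans_inv /=.
by have := cval_neq0 (lin g) => g0; field.
Qed.

Lemma Hom_lambda_conj (lambda : {multiplicative Lambda n -> Cstar R}) rho g :
  Hom_lambda lambda rho -> Hom_lambda lambda (fun x => g * rho x * g^-1).
Proof.
move=> [rM rl]; split=> [x y|x]; first by rewrite rM !mulgA mulgVK.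
by rewrite -[LHS]/(lin (g * rho x * g^-1)) lin_conj -rl.
Qed.

Definition translation rho (k : 'I_n) : C := trans (rho (alpha k)).

Variable lambda : {multiplicative Lambda n -> Cstar R}.

Lemma Hom_lambda_comp rho (phi : Lambda n -> Lambda n) :
  {morph phi : x y / x * y} -> lambda \o phi =1 lambda ->
  Hom_lambda lambda rho -> Hom_lambda lambda (rho \o phi).
Proof.
move=> pM pl [rM rl]; split=> [x y|x]; first by rewrite /= pM rM.
by rewrite -pl -[RHS]rl.
Qed.

Let lambdaV : {morph lambda : x / x^-1} := morph_inv (@gmulfM _ _ lambda).

(** The quantifier over [rho] makes [a] and [c] depend on [lambda] alone. Membership in [Hom_lambda]
    is part of the conclusion so that such maps can be chained. *)
Definition transvects (i j : 'I_n) (phi : Lambda n -> Lambda n) (a c : C) :=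
  forall rho, Hom_lambda lambda rho ->
  [/\ Hom_lambda lambda (rho \o phi),
      translation (rho \o phi) i = (a * translation rho i)%R,
      translation (rho \o phi) j = (translation rho j + c * translation rho i)%R &
      forall k, k != i -> k != j -> translation (rho \o phi) k = translation rho k].

Lemma trans_morph_conj rho x y : Hom_lambda lambda rho ->
  trans (rho (x * y * x^-1)) =
  (cval (lambda x) * trans (rho y) + (1 - cval (lambda y)) * trans (rho x))%R.
Proof. by move=> [rM rl]; rewrite !rM (morph_inv rM) trans_conj -!rl. Qed.

(** The full twist conjugates [alpha i] and [alpha j], which is invisible in the commutative group
    [Cstar]. *)
Lemma full_twist_linear (i j : 'I_n) :
  i < j -> lambda \o full_twist i j =1 lambda.
Proof.
move=> ij; apply: Lambda_morph_eq => [x y|x y|k /=].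
- by rewrite /= full_twistM// gmulfM.
- exact: gmulfM.
have conjE x y : lambda (x * y * x^-1) = lambda y.
  by rewrite !gmulfM lambdaV cstar_mulC mulgA mulVg mul1g.
have [->|ki] := eqVneq k i; first by rewrite full_twist_alpha_l// conjE.
have [->|kj] := eqVneq k j; first by rewrite full_twist_alpha_r// conjE.
by rewrite full_twist_alpha_id.
Qed.

Lemma Hom_lambda_full_twist (i j : 'I_n) rho : i < j ->
  Hom_lambda lambda rho -> Hom_lambda lambda (rho \o full_twist i j).
Proof.
move=> ij; apply: Hom_lambda_comp; first exact: full_twistM.
exact: full_twist_linear.
Qed.

(** As [lambda (alpha i) = 1], conjugating [alpha i] merely rescales its translation, by the linear
    part of the conjugator. The conjugator [Q^-1 * alpha i * Q] of [alpha j] is itself a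
    translation, by that of [alpha i] divided by the linear part of [Q]. *)
Lemma full_twist_transvects_lt (i j : 'I_n) :
  i < j -> lambda (alpha i) = 1 ->
  transvects i j (full_twist i j) (cval (lambda (alpha j)))
    ((1 - cval (lambda (alpha j))) / cval (lambda (alpha_prod n i.+1 j)))%R.
Proof.
move=> ij li rho rhoH; have [rM rl] := rhoH.
have rV := morph_inv rM.
have linE x : lin (rho x) = lambda x := rl x.
have q0 := cval_neq0 (lambda (alpha_prod n i.+1 j)).
rewrite /translation /=; split; first exact: Hom_lambda_full_twist.
- rewrite full_twist_alpha_l// trans_morph_conj// !gmulfM lambdaV li /=.
  by field.
- rewrite full_twist_alpha_r// trans_morph_conj// !gmulfM lambdaV li.
  by rewrite !rM rV !(trans_mul, trans_inv) /= !linE li /=; field.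
- by move=> k ki kj; rewrite full_twist_alpha_id.
Qed.

(** Here [alpha j] is the left generator, conjugated by [alpha j * (Q * alpha i * Q^-1)]. The factor
    [alpha j] commutes with it but rescales the contribution of [alpha i], so [c] differs from the
    case [i < j]. *)
Lemma full_twist_transvects_gt (i j : 'I_n) :
  j < i -> lambda (alpha i) = 1 ->
  transvects i j (full_twist j i) (cval (lambda (alpha j)))
    ((1 - cval (lambda (alpha j))) *
     (cval (lambda (alpha j)) * cval (lambda (alpha_prod n j.+1 i))))%R.
Proof.
move=> ji li rho rhoH; have [rM rl] := rhoH.
have rV := morph_inv rM.
have linE x : lin (rho x) = lambda x := rl x.
have q0 := cval_neq0 (lambda (alpha_prod n j.+1 i)).
rewrite /translation /=; split; first exact: Hom_lambda_full_twist.
- rewrite full_twist_alpha_r// trans_morph_conj// !gmulfM lambdaV li /=.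
  by field.
- rewrite full_twist_alpha_l// trans_morph_conj// !gmulfM lambdaV li.
  by rewrite !rM rV !(trans_mul, trans_inv) /= !linE li /=; field.
- by move=> k ki kj; rewrite full_twist_alpha_id.
Qed.

Lemma transvects_inv (i j : 'I_n) phi psi (a c : C) :
  a != 0%R -> {morph phi : x y / x * y} -> lambda \o phi =1 lambda ->
  cancel phi psi -> cancel psi phi ->
  transvects i j phi a c -> transvects i j psi a^-1%R (- (c / a))%R.
Proof.
move=> a0 pM pl K1 K2 T rho rhoH.
have qM : {morph psi : x y / x * y}.
  by move=> x y; rewrite -{1}[x]K2 -{1}[y]K2 -pM K1.
have ql : lambda \o psi =1 lambda by move=> x; rewrite -[LHS](pl (psi x)) /= K2.
have H := Hom_lambda_comp qM ql rhoH.
(* The formulas for [phi] at [rho \o psi] express [rho] through [rho \o psi]; they are then solved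
   for the latter. *)
have [_] := T _ H; have -> : (rho \o psi) \o phi = rho.
  by apply: funext => x /=; rewrite K1.
move=> -> -> E; split=> //; first by rewrite mulKf.
  by field.
by move=> k ki kj; rewrite E.
Qed.

(** Both orders of [i] and [j] give the same multiplier. The constant [c] differs, but only its
    being nonzero matters later. *)
Lemma exists_transvection (i j : 'I_n) :
  i != j -> lambda (alpha i) = 1 -> lambda (alpha j) != 1 ->
  exists phi psi c,
  [/\ pure_hurwitz phi, pure_hurwitz psi, c != 0%R,
      transvects i j phi (cval (lambda (alpha j))) c &
      transvects i j psi (cval (lambda (alpha j)))^-1%R
        (- (c / cval (lambda (alpha j))))%R].
Proof.
move=> ij li lj; have a0 := cval_neq0 (lambda (alpha j)).
have a1 : (1 - cval (lambda (alpha j)) != 0)%R.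
  by rewrite subr_eq0 eq_sym; apply: contra lj => /eqP E; apply/eqP/val_inj.
have [ltij|ltji|/val_inj ijE] := ltngtP i j; last by rewrite ijE eqxx in ij.
  have [psi Ppsi [K1 K2]] := full_twist_inv ltij.
  have T := full_twist_transvects_lt ltij li.
  exists (full_twist i j), psi; eexists; split; last first.
  - apply: transvects_inv K1 K2 T => //; first exact: full_twistM.
    exact: full_twist_linear.
  - exact: T.
  - by rewrite mulf_neq0// invr_eq0 cval_neq0.
  - by [].
  - exact: pure_hurwitz_full_twist.
have [psi Ppsi [K1 K2]] := full_twist_inv ltji.
have T := full_twist_transvects_gt ltji li.
exists (full_twist j i), psi; eexists; split; last first.
- apply: transvects_inv K1 K2 T => //; first exact: full_twistM.
  exact: full_twist_linear.
- exact: T.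
- by rewrite !mulf_neq0// cval_neq0.
- by [].
- exact: pure_hurwitz_full_twist.
Qed.

Lemma exists_unipotent (i j k : 'I_n) : j != k ->
  lambda (alpha i) = 1 -> lambda (alpha j) != 1 -> lambda (alpha k) != 1 ->
  exists chi e, [/\ pure_hurwitz chi, e != 0%R &
  forall rho, Hom_lambda lambda rho ->
  [/\ Hom_lambda lambda (rho \o chi),
      translation (rho \o chi) i = translation rho i,
      translation (rho \o chi) j = (translation rho j + e * translation rho i)%R &
      forall l, l != i -> l != j -> l != k ->
      translation (rho \o chi) l = translation rho l]].
Proof.
move=> jk li lj lk.
have ij : i != j by apply: contraNneq lj => <-; rewrite li.
have ik : i != k by apply: contraNneq lk => <-; rewrite li.
have ji : j != i by rewrite eq_sym.
have [A [A' [c [PA PA' c0 TA TA']]]] := exists_transvection ij li lj.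
have [B [B' [d [PB PB' _ TB TB']]]] := exists_transvection ik li lk.
have a0 := cval_neq0 (lambda (alpha j)).
have b0 := cval_neq0 (lambda (alpha k)).
have b1 : (1 - cval (lambda (alpha k)) != 0)%R.
  by rewrite subr_eq0 eq_sym; apply: contra lk => /eqP E; apply/eqP/val_inj.
(* On the coordinate of [j], [A] adds [c] times the coordinate of [i]. [A'] subtracts the same
   multiple after [B] has rescaled that coordinate by [lambda (alpha k)]; the difference is the
   second witness. *)
exists (A \o B \o A' \o B'), (c * (1 - cval (lambda (alpha k))))%R; split.
- by do 3 apply: pure_hurwitz_comp => //.
- by rewrite mulf_neq0.
move=> rho /TA[/TB[/TA'[/TB'[H ti _ tl] t'i t'j t'l] t''i _ t''l] t3i t3j t3l].
rewrite -[rho \o (A \o B \o A' \o B')]/(rho \o A \o B \o A' \o B').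
split=> //.
- by rewrite ti t'i t''i t3i; field; rewrite ?a0 ?b0.
- by rewrite tl// t'j t''l// t''i t3i t3j; field; rewrite ?a0 ?b0.
- by move=> l xi xj xk; rewrite tl// t'l// t''l// t3l.
Qed.

End Translation.

(** * Infinite orbit from a nonzero translation with trivial linear part *)

Theorem theorem2p3p3 (R : realType) (n : nat) (hn : 4 <= n)
    (lambda : {multiplicative Lambda n -> Cstar R})
    (hlambda : 2 < nontriviality_index lambda)
    (rho : Lambda n -> Aff R)
    (hrho : PH lambda (conj_class rho))
    (horbit : finite_set (pure_braid_orbit (conj_class rho))) :
  forall i : 'I_n, lambda (alpha i) = 1 -> aff_fun (rho (alpha i)) =1 id.
Proof.
move=> i li.
have conj_refl (r : Lambda n -> Aff R) : conj_class r r.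
  by exists 1 => //; apply: funext => x; rewrite mul1g invg1 mulg1.
have rhoH : Hom_lambda lambda rho.
  (* [PH] only provides some [rho0] with the same class, of which [rho] is a conjugate. *)
  have [rho0 [rho0H _] E] := hrho.
  have [g _ <-] : conj_class rho0 rho by rewrite E.
  exact: Hom_lambda_conj.
have [_ rl] := rhoH.
suff t0 : translation rho i = 0%R.
  have rli : lin (rho (alpha i)) = 1 := etrans (rl _) li.
  move=> z; rewrite /aff_fun rli.
  by rewrite -[trans _]/(translation rho i) t0 /= mul1r addr0.
apply/eqP/negPn/negP => t0.
(* The indices [j] and [k] serve to build the commutator; [l] is kept aside as a coordinate that it
   fixes. *)
have [j [k [l [[lj lk ll] [jk kl lj']]]]] := card_gt2P hlambda.
rewrite !inE in lj lk ll.
have il : l != i by apply: contraNneq ll => ->; rewrite li.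
have [chi [e [Pchi e0 chiT]]] := exists_unipotent jk li lj lk.
(* Each iteration composes with [chi] on the right, so [chiT] applies to the representation reached
   so far. *)
have iterP m : pure_hurwitz (iter m (fun f => f \o chi) id).
  elim: m => [|m IH] /=; first exact: pure_hurwitz_id.
  exact: pure_hurwitz_comp.
have iterT m : let r := rho \o iter m (fun f => f \o chi) id in
  [/\ Hom_lambda lambda r, translation r i = translation rho i,
      translation r j = (translation rho j + m%:R * (e * translation rho i))%R &
      translation r l = translation rho l].
  elim: m => [|m [/chiT[H ti tj tl] IHi IHj IHl]]; first by rewrite mul0r addr0.
  split=> //.
  - by rewrite ti.
  - by rewrite tj IHi IHj -natr1; ring.
  - by rewrite tl// eq_sym.
pose F m := braid_act (iter m (fun f => f \o chi) id) (conj_class rho).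
(* An injective [F] from [nat] into the finite orbit would make [nat] finite; injectivity of [F]
   remains. *)
apply: infinite_nat; rewrite -(preimage_setT F).
have -> : F @^-1` setT = F @^-1` (pure_braid_orbit (conj_class rho)).
  by apply/seteqP; split=> // m _; exists (iter m (fun f => f \o chi) id).
apply: finite_preimage horbit => m p _ _ E.
have : F m (rho \o iter m (fun f => f \o chi) id) by exists rho.
rewrite E => -[_ [g _ <-] gE].
have [_ mi mj ml] := iterT m.
have [[_ pl] pi pj pt] := iterT p.
have tE s : translation (rho \o iter m (fun f => f \o chi) id) s =
    (cval (lin g) * translation (rho \o iter p (fun f => f \o chi) id) s
     + (1 - cval (lambda (alpha s))) * trans g)%R.
  by rewrite -gE [LHS]trans_conj -pl.
(* At [i] the term in [trans g] vanishes, and both powers keep the nonzero coordinate of [rho]. *)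
have g1 : cval (lin g) = 1%R.
  apply: (mulIf t0); rewrite mul1r -{2}mi tE pi li /=.
  by rewrite subrr mul0r addr0.
(* At [l] the unchanged coordinates cancel, leaving a product with the nonzero factor
   [1 - cval (lambda (alpha l))]. *)
have g0 : trans g = 0%R.
  move: (tE l); rewrite ml pt g1 mul1r => /esym/eqP.
  rewrite -subr_eq0 addrAC subrr add0r mulf_eq0 subr_eq0 => /orP[/eqP|/eqP//].
  by move=> E1; case/eqP: ll; apply: val_inj.
(* At [j] the equality now compares [m] and [p] times the same nonzero number, in characteristic
   zero. *)
move: (tE j); rewrite mj pj g1 g0 mul1r mulr0 addr0 => /addrI.
move=> /(mulIf (mulf_neq0 e0 t0))/eqP.
by rewrite Num.Theory.eqr_nat => /eqP.
Qed.
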